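(* Fix a constant $\epsilon>0$. For the online set cover with repetitions problem with unit set costs described in the context, there is a deterministic online algorithm which, at every time, covers each element that has been presented $k$ times so far by at least $(1-\epsilon)k$ distinct chosen sets, and whose total number of chosen sets is $O(\log m\log n)\cdot\alpha$, where $\alpha$ is the size of an optimal cover (the constant depending on $\epsilon$).
   Context: Online set cover with repetitions, unit costs: a ground set $X$ of $n$ elements and a family $\mathcal S$ of $m$ subsets of $X$ are known in advance. An adversary presents elements of $X$ one at a time; each element may be presented an arbitrary number of times, not necessarily consecutively. The algorithm chooses sets irrevocably. An optimal cover is a minimum-size collection of sets covering each element presented $k$ times by at least $k$ distinct sets of the collection; $\alpha$ is its size (assumed to exist). *)

(* Defs.v *)
From HB Require Import structures.
From mathcomp Require Import all_boot all_order all_algebra.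
From mathcomp Require Import all_classical all_reals all_analysis.

Set Implicit Arguments.
Unset Strict Implicit.
Unset Printing Implicit Defensive.

Import Order.TTheory GRing.Theory Num.Theory.

Local Open Scope ring_scope.

(* The requests presented so far form a sequence s : seq X in order of arrival,
   so count_mem x s is the number k of times that x has been presented. *)

Definition cover_count (X : finType) (C : {set {set X}}) (x : X) : nat :=
  #|[set A in C | x \in A]|.

Definition is_cover (X : finType) (S : {set {set X}}) (s : seq X)
    (C : {set {set X}}) : Prop :=
  C \subset S /\ forall x : X, (count_mem x s <= cover_count C x)%N.

Definition is_optimal_cover (X : finType) (S : {set {set X}}) (s : seq X)
    (C : {set {set X}}) : Prop :=
  is_cover S s C /\
  forall C' : {set {set X}}, is_cover S s C' -> (#|C| <= #|C'|)%N.

(* A deterministic online algorithm maps each request history to the collection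
   of all the sets it has chosen up to that point. It depends on nothing but
   the history (and on X and S, known in advance); monotonicity in the history
   says that choices are irrevocable. *)
Definition is_online_algorithm (X : finType) (S : {set {set X}})
    (alg : seq X -> {set {set X}}) : Prop :=
  (forall s : seq X, alg s \subset S) /\
  (forall (s : seq X) (x : X), alg s \subset alg (rcons s x)).

Definition covers_up_to (R : realType) (eps : R) (X : finType) (s : seq X)
    (C : {set {set X}}) : Prop :=
  forall x : X, (1 - eps) * (count_mem x s)%:R <= (cover_count C x)%:R.

(* Main.v *)
Require Import Defs.
From HB Require Import structures.
From mathcomp Require Import all_boot all_order all_algebra.
From mathcomp Require Import all_classical all_reals all_analysis.
From mathcomp Require Import zify ring lra.

(* Multiplicative weights with a derandomized rounding. Every set A carries a
   weight w_A, initially 1/(2m), and counts as chosen once w_A >= 1 or once the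
   rounding has picked it. When an element x requested k times is covered fewer
   than (1 - eps) k times, the weights of the unchosen sets containing x are
   multiplied by 1 + 1/(2k); then at most L, about 4 ln n, of these sets are
   picked so that Phi = sum_x n^(2 (w_x - cover_x)) does not increase, where w_x
   is the total weight of the sets containing x. Since Phi <= n^2, we have
   w_x <= cover_x + 1, so one augmentation adds at most 1/2 to the total weight;
   a random pick proportional to the weight increments does not increase Phi on
   average. An augmentation hits at least eps k sets of any feasible cover, so
   it raises the sum of ln (2 m w_A) over that cover by at least eps / 3; as
   w_A <= 3/2, there are at most O(log m / eps) alpha augmentations. *)

Set Implicit Arguments.
Unset Strict Implicit.
Unset Printing Implicit Defensive.

Import Order.TTheory GRing.Theory Num.Theory.

Local Open Scope ring_scope.

(** * Logarithmic and exponential estimates *)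

Lemma ln1D_ge (R : realType) (y : R) : 0 <= y -> y / (1 + y) <= ln (1 + y).
Proof.
move=> y0; have y1 : 0 < 1 + y by lra.
have h : 0 < 1 - y / (1 + y) by rewrite [X in 0 < X](_ : _ = (1 + y)^-1) ?invr_gt0//; field; lra.
have -> : ln (1 + y) = - ln (1 - y / (1 + y)).
  by rewrite -lnV ?posrE//; congr ln; field; lra.
rewrite lerNr.
have := @le_ln1Dx R (- (y / (1 + y))).
rewrite ltrNl opprK; apply.
by rewrite ltr_pdivrMr //; lra.
Qed.

(** Reweighting multiplies a potential term by [y = expR (2 * l * d)]; the bracket is the expected
    effect of [L] picks, a factor [1] if all miss and [expR (- (2 * l))] otherwise. As [L >= 4 * l],
    [(1 - d) ^+ L] is at most [y ^- 2]; with [z = expR l] the claim becomes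
    [(y - 1) * (z ^+ 2 - (y + 1)) >= 0], true since [1 <= y <= z] and [2 <= z]. *)
Lemma rounding_factor (R : realType) (l d : R) (L : nat) :
  2 <= expR l -> 0 <= d <= 1 / 2 -> 4 * l <= L%:R ->
  expR (2 * l * d) * (expR (- (2 * l)) + (1 - expR (- (2 * l))) * (1 - d) ^+ L)
    <= 1.
Proof.
move=> l2 /andP[d0 d2] lL.
have l0 : 0 <= l by rewrite -ler_expR expR0; lra.
set y := expR (2 * l * d); set z := expR l in l2 *.
have zE : expR (- (2 * l)) = (z ^+ 2)^-1 by rewrite expRN -expRM_natl.
have y1 : 1 <= y by rewrite -[1]expR0 ler_expR; nra.
have yz : y <= z by rewrite ler_expR; nra.
have pw : (1 - d) ^+ L <= (y ^+ 2)^-1.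
  rewrite -expRM_natl -expRN.
  apply: (@le_trans _ _ (expR (- d) ^+ L)).
    apply: lerXn2r; rewrite ?nnegrE ?expR_ge0//; first lra.
    exact: (expR_ge1Dx (- d)).
  by rewrite -expRM_natl ler_expR; nra.
have q01 : 0 <= 1 - (z ^+ 2)^-1.
  by rewrite subr_ge0 invf_le1 ?exprn_gt0 ?expR_gt0// expr2; nra.
rewrite zE; apply: (@le_trans _ _ (y * ((z ^+ 2)^-1 + (1 - (z ^+ 2)^-1) * (y ^+ 2)^-1))).
  by rewrite ler_pM2l ?lerD2l ?ler_wpM2l//; lra.
have -> : y * ((z ^+ 2)^-1 + (1 - (z ^+ 2)^-1) * (y ^+ 2)^-1)
     = (y ^+ 2 + z ^+ 2 - 1) / (y * z ^+ 2).
  by field; rewrite !gt_eqF ?expR_gt0.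
rewrite ler_pdivrMr ?mul1r.
  have : 0 <= (y - 1) * (z ^+ 2 - (y + 1)) by rewrite mulr_ge0//; nra.
  by rewrite expr2; nra.
by rewrite mulr_gt0 ?exprn_gt0//; lra.
Qed.

(** * Derandomized picking *)

Section Greedy.
Variables (R : realType) (I J : finType) (P : {set J}) (d : J -> R).
Variable r : J -> I -> bool.
Hypothesis d_ge0 : forall j, j \in P -> 0 <= d j.
Hypothesis d_sum : \sum_(j in P) d j <= 1.

Definition misses (D : {set J}) (i : I) : bool := [forall j in D, ~~ r j i].
Definition hit_rate (i : I) : R := \sum_(j in P | r j i) d j.

Lemma hit_rate_ge0 i : 0 <= hit_rate i.
Proof. by apply: sumr_ge0 => j /andP[jP _]; exact: d_ge0. Qed.

Lemma hit_rate_le i : hit_rate i <= \sum_(j in P) d j.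
Proof.
rewrite /hit_rate big_mkcondr /=; apply: ler_sum => j jP.
by case: ifP => // _; exact: d_ge0.
Qed.

(** The [j] of largest gain does at least as well as a random pick: gains are nonnegative, and the
    probability by which the sum of [d] falls short of 1 stands for no pick. *)
Lemma single_pick_average (b : I -> R) : (forall i, 0 <= b i) ->
  exists D : {set J}, [/\ D \subset P, (#|D| <= 1)%N &
    \sum_i b i * (misses D i)%:R <= \sum_i b i * (1 - hit_rate i)].
Proof.
move=> b0; case: (set_0Vmem P) => [P0|[j0 j0P]].
  exists finset.set0; split; rewrite ?finset.sub0set ?cards0//.
  apply: ler_sum => i _; rewrite /hit_rate P0.
  rewrite big1 => [|j]; last by rewrite inE.
  by rewrite subr0; apply: ler_wpM2l => //; case: misses.
pose gain j : R := \sum_i b i * (r j i)%:R.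
case: (@arg_maxP _ _ _ j0 (mem P) gain j0P) => j jP jmax.
exists [set j]; split; rewrite ?finset.sub1set ?cards1//.
have -> : \sum_i b i * (misses [set j] i)%:R = \sum_i b i - gain j.
  rewrite -sumrB; apply: eq_bigr => i _.
  have -> : misses [set j] i = ~~ r j i.
    apply/forallP/idP => [/(_ j)|h j']; rewrite inE ?eqxx//.
    by apply/implyP => /eqP->.
  by case: (r j i); rewrite /= ?(mulr0, mulr1, subr0, subrr).
have -> : \sum_i b i * (1 - hit_rate i) = \sum_i b i - \sum_i b i * hit_rate i.
  by rewrite -sumrB; apply: eq_bigr => i _; rewrite mulrBr mulr1.
rewrite lerD2l lerN2.
have -> : \sum_i b i * hit_rate i = \sum_(j in P) d j * gain j.
  under eq_bigr do rewrite /hit_rate big_distrr/= big_mkcondr/=.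
  rewrite exchange_big /=; apply: eq_bigr => j' _.
  rewrite /gain big_distrr /=; apply: eq_bigr => i _.
  by case: (r j' i); rewrite ?(mulr1, mulr0) // mulrC.
have g0 : 0 <= gain j by apply: sumr_ge0 => i _; rewrite mulr_ge0.
apply: (@le_trans _ _ (\sum_(j' in P) d j' * gain j)).
  by apply: ler_sum => j' j'P; rewrite ler_wpM2l ?d_ge0//; exact: jmax.
by rewrite -big_distrl/= ler_piMl.
Qed.

(* Derandomization of L independent picks, j being picked with probability
   d j each time: hit_rate i is the probability that one pick hits i. *)
Lemma greedy_hitting (L : nat) (a : I -> R) : (forall i, 0 <= a i) ->
  exists D : {set J}, [/\ D \subset P, (#|D| <= L)%N &
    \sum_i a i * (misses D i)%:R <= \sum_i a i * (1 - hit_rate i) ^+ L].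
Proof.
have h01 i : 0 <= 1 - hit_rate i.
  by rewrite subr_ge0 (le_trans (hit_rate_le i)).
elim: L a => [|L IH] a a0.
  exists finset.set0; split; rewrite ?finset.sub0set ?cards0//.
  by apply: ler_sum => i _; rewrite expr0 ler_wpM2l//; case: misses.
(* Conditional expectations: the first pick is judged as if the other [L] were still random; the
   induction then treats the elements it missed. *)
have [|D1 [D1P D1c D1h]] := single_pick_average (b := fun i => a i * (1 - hit_rate i) ^+ L).
  by move=> i; rewrite mulr_ge0 ?exprn_ge0.
have [|D2 [D2P D2c D2h]] := IH (fun i => a i * (misses D1 i)%:R).
  by move=> i; rewrite mulr_ge0.
exists (D1 :|: D2); split; first by rewrite finset.subUset D1P.
  by apply: leq_trans (leq_card_setU _ _) _; rewrite -add1n leq_add.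
apply: (@le_trans _ _ (\sum_i a i * (misses D1 i)%:R * (misses D2 i)%:R)).
  apply: ler_sum => i _; rewrite -mulrA ler_wpM2l// -natrM mulnb ler_nat.
  suff -> : misses (D1 :|: D2) i = misses D1 i && misses D2 i by [].
  apply/forall_inP/andP => [h|[/forall_inP h1 /forall_inP h2] j].
    by split; apply/forall_inP => j jD; apply: h; rewrite inE jD ?orbT.
  by rewrite inE => /orP[/h1|/h2].
apply: le_trans D2h _; under eq_bigr do rewrite mulrAC.
apply: le_trans D1h _.
by apply: ler_sum => i _; rewrite exprSr mulrA.
Qed.
End Greedy.

Lemma cover_countS (X : finType) (C C' : {set {set X}}) (x : X) :
  C \subset C' -> (cover_count C x <= cover_count C' x)%N.
Proof.
move=> /fintype.subsetP CC'; apply/subset_leq_card/fintype.subsetP => A.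
by rewrite !inE => /andP[/CC'-> ->].
Qed.

(** * The state, its invariant, and the bounds drawn from it *)

Section Algorithm.
Variables (R : realType) (eps : R) (X : finType) (S : {set {set X}}) (L : nat).

Local Notation n := (#|X|).
Local Notation m := (#|S|).
Local Notation l := (ln n%:R : R).

Hypothesis eps_gt0 : 0 < eps.
Hypothesis n_ge2 : (2 <= n)%N.
Hypothesis m_ge2 : (2 <= m)%N.
Hypothesis L_ge : 4 * l <= L%:R.

Record state := State {
  weight : {set X} -> R;
  rounded : {set {set X}};
  augmentations : nat }.

Definition chosen (st : state) : {set {set X}} :=
  rounded st :|: [set A in S | 1 <= weight st A].

Definition elt_weight (w : {set X} -> R) (x : X) : R :=
  \sum_(A in S | x \in A) w A.

Definition potential (w : {set X} -> R) (C : {set {set X}}) : R :=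
  \sum_x expR (2 * l * (elt_weight w x - (cover_count C x)%:R)).

(** The history enters only through [augmentations_log], which ranges over all feasible covers
    because the algorithm does not know an optimal one; a longer history has fewer covers, so new
    requests preserve it. *)
Record invariant (s : seq X) (st : state) : Prop := Invariant {
  rounded_sub : rounded st \subset S;
  weight_gt0 : forall A, A \in S -> 0 < weight st A;
  weight_le : forall A, A \in S -> weight st A <= 3 / 2;
  weight_sum : \sum_(A in S) weight st A <= ((augmentations st)%:R + 1) / 2;
  card_rounded : (#|rounded st| <= L * augmentations st)%N;
  potential_le : potential (weight st) (chosen st) <= expR (2 * l);
  augmentations_log : forall Opt, is_cover S s Opt ->
    eps / 3 * (augmentations st)%:R
      <= \sum_(A in Opt) ln (2 * m%:R * weight st A) }.

Let n_gt0 : 0 < n%:R :> R. Proof. by rewrite ltr0n; lia. Qed.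
Let m_gt0 : 0 < m%:R :> R. Proof. by rewrite ltr0n; lia. Qed.
Let expl : expR l = n%:R. Proof. by rewrite lnK ?posrE. Qed.
Let l_gt0 : 0 < l. Proof. by rewrite ln_gt0// ltr1n. Qed.

Lemma chosen_sub s st : invariant s st -> chosen st \subset S.
Proof.
move=> inv; rewrite finset.subUset (rounded_sub inv)/=.
by apply/fintype.subsetP => A; rewrite inE => /andP[].
Qed.

Definition init : state := State (fun=> (2 * m%:R)^-1) finset.set0 0.

Lemma invariant_init : invariant [::] init.
Proof.
have m2 : 2 <= m%:R :> R by rewrite ler_nat.
have w1 : (2 * m%:R)^-1 <= 1 / 2 :> R.
  by rewrite mul1r lef_pV2 ?posrE; lra.
have wsum : \sum_(A in S) (2 * m%:R)^-1 = 1 / 2 :> R.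
  by rewrite sumr_const -mulr_natl; field; lra.
split => //=.
- exact: finset.sub0set.
- by move=> A _; rewrite invr_gt0; lra.
- by move=> A _; lra.
- by rewrite wsum; lra.
- by rewrite cards0.
(* Initially each element has weight at most 1/2, so each of the [n] terms is at most
   [expR l = n]. *)
- have -> : expR (2 * l) = \sum_(x : X) expR l.
    by rewrite sumr_const expRM_natl expr2 expl mulr_natr.
  apply: ler_sum => x _; rewrite ler_expR.
  have : elt_weight (fun=> (2 * m%:R)^-1) x <= 1 / 2.
    apply: (@le_trans _ _ (\sum_(A in S) (2 * m%:R)^-1)).
      rewrite /elt_weight big_mkcondr/=; apply: ler_sum => A _.
      by case: ifP => // _; rewrite invr_ge0; lra.
    by rewrite wsum.
  have : 0 <= (cover_count (chosen init) x)%:R :> R by [].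
  by have := l_gt0; nra.
- move=> Opt _; rewrite mulr0; apply: sumr_ge0 => A _.
  by rewrite divff ?ln1//; lra.
Qed.

Lemma invariant_rcons s x st : invariant s st -> invariant (rcons s x) st.
Proof.
case=> *; split => // Opt [OptS cov].
suff : is_cover S s Opt by auto.
split=> // y; apply: leq_trans (cov y).
by rewrite -cats1 count_cat leq_addr.
Qed.

Lemma augmentations_le s st Opt : invariant s st -> is_cover S s Opt ->
  (augmentations st)%:R <= 9 / eps * ln m%:R * #|Opt|%:R.
Proof.
move=> inv cov; have h := augmentations_log inv cov.
have m2 : 2 <= m%:R :> R by rewrite ler_nat.
suff h3 : eps / 3 * (augmentations st)%:R <= 3 * ln m%:R * #|Opt|%:R.
  rewrite [leRHS](_ : _ = 3 * ln m%:R * #|Opt|%:R / (eps / 3)); last first.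
    by field; rewrite gt_eqF.
  by rewrite ler_pdivlMr ?divr_gt0// mulrC.
apply: le_trans h _; rewrite [leRHS]mulr_natr -[leRHS]sumr_const.
apply: ler_sum => A AO; have AS : A \in S := fintype.subsetP cov.1 A AO.
have w0 := weight_gt0 inv AS; have w1 := weight_le inv AS.
(* Since [w <= 3 / 2] and [m >= 2], [2 * m * w <= 3 * m <= m ^ 3]. *)
rewrite [leRHS]mulr_natl -lnXn// ler_ln ?posrE ?exprn_gt0//; last by nra.
by rewrite !exprS expr0; nra.
Qed.

Lemma card_chosen s st : invariant s st ->
  (#|chosen st| <= L.+1 * augmentations st)%N.
Proof.
move=> inv; apply: leq_trans (leq_card_setU _ _) _.
rewrite mulSn addnC leq_add ?(card_rounded inv)//.
set H := [set A in S | _].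
(* Integrality matters: before any augmentation this forces [H] to be empty, and afterwards half of
   [t + 1] is at most [t]. *)
suff : (#|H| * 2 <= augmentations st + 1)%N by lia.
rewrite -(ler_nat R) natrM natrD.
suff : #|H|%:R <= \sum_(A in S) weight st A by have := weight_sum inv; lra.
rewrite -sum1_card natr_sum /H.
under eq_bigl do rewrite inE.
rewrite big_mkcondr; apply: ler_sum => A AS /=.
by case: ifP => // _; exact: ltW (weight_gt0 inv AS).
Qed.

Lemma elt_weight_le s st x : invariant s st ->
  elt_weight (weight st) x <= (cover_count (chosen st) x)%:R + 1.
Proof.
move=> inv; have := potential_le inv; rewrite /potential (bigD1 x)//=.
set rest := \sum_(_ | _) _ => h.
have r0 : 0 <= rest by apply: sumr_ge0 => y _; exact: expR_ge0.
have : expR (2 * l * (elt_weight (weight st) x - (cover_count (chosen st) x)%:R))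
   <= expR (2 * l) by lra.
rewrite ler_expR => {}h; have h2 : 0 < 2 * l by have := l_gt0; lra.
by rewrite -lerBlDl -(ler_pM2l h2) mulr1.
Qed.

(** * One augmentation *)

(* The increments d A, of total at most 1/2, are used as picking probabilities;
   [rounding_factor] bounds the expected growth of each term of the potential. *)
Lemma augment s st x : invariant s st ->
  (cover_count (chosen st) x)%:R < (1 - eps) * (count_mem x s)%:R ->
  exists st', [/\ invariant s st', chosen st \subset chosen st'
    & augmentations st' = (augmentations st).+1].
Proof.
move=> inv; set k := count_mem x s; set C := chosen st => Ck.
pose w := weight st.
have k0 : (0 < k)%N.
  by rewrite lt0n; apply/eqP => k0; move: Ck; rewrite k0 mulr0 ltrn0.
have k1 : 1 <= k%:R :> R by rewrite ler1n.
(* Integrality absorbs the [+ 1] of [elt_weight_le]: the weight at [x] is at most [k], so the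
   increments [w A / (2 * k)] sum to at most 1/2. *)
have Ck1 : (cover_count C x).+1%:R <= k%:R :> R.
  rewrite ler_nat -(ltr_nat R).
  have : 0 < eps * k%:R by rewrite mulr_gt0//; lra.
  by lra.
pose P := [set A in S | (x \in A) && (A \notin C)].
have PS A : A \in P -> A \in S by rewrite inE => /andP[].
have Pw A : A \in P -> w A < 1.
  rewrite !inE => /and3P[AS _]; rewrite negb_or AS /= => /andP[_].
  by rewrite -ltNge.
pose d A : R := w A / (2 * k%:R).
have d0 A : A \in S -> 0 <= d A.
  by move=> AS; rewrite divr_ge0 ?ltW ?(weight_gt0 inv)//; lra.
have dsum : \sum_(A in P) d A <= 1 / 2.
  rewrite -big_distrl/= ler_pdivrMr; last by lra.
  suff : \sum_(A in P) w A <= k%:R by lra.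
  have := elt_weight_le x inv; rewrite -/C -/w => hw.
  apply: (@le_trans _ _ (elt_weight w x)).
    rewrite /elt_weight /P; under eq_bigl do rewrite inE andbA.
    rewrite big_mkcondr; apply: ler_sum => A /andP[AS _] /=.
    by case: ifP => // _; exact: ltW (weight_gt0 inv AS).
  by apply: le_trans hw _; rewrite natr1.
pose r (A : {set X}) (i : X) := i \in A.
have dP A : A \in P -> 0 <= d A by move=> /PS; exact: d0.
have dsum1 : \sum_(A in P) d A <= 1 by lra.
pose rate := hit_rate P d r.
have rate0 i : 0 <= rate i <= 1 / 2.
  rewrite (hit_rate_ge0 r dP)/=; apply: le_trans (hit_rate_le r dP i) dsum.
pose phi i := expR (2 * l * (elt_weight w i - (cover_count C i)%:R)).
(* The potential term of [i] after the reweighting but before the picks. *)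
pose a i := phi i * expR (2 * l * rate i).
have a0 i : 0 <= a i by rewrite mulr_ge0 ?expR_ge0.
have [D [DP Dc Dh]] := greedy_hitting r dP dsum1 L a0.
pose w' A := w A + (A \in P)%:R * d A.
have ww' A : A \in S -> w A <= w' A.
  by move=> AS; rewrite lerDl mulr_ge0 ?d0.
pose st' := State w' (rounded st :|: D) (augmentations st).+1.
have CC' : C :|: D \subset chosen st'.
  apply/fintype.subsetP => A; rewrite !inE -!orbA => /or3P[->//|/andP[AS wA]|->].
    by rewrite AS (le_trans wA (ww' A AS)) !orbT.
  by rewrite orbT.
exists st'; split => //; last exact: fintype.subset_trans (finset.subsetUl _ _) CC'.
split => /=.
- rewrite finset.subUset (rounded_sub inv)/=.
  by apply/fintype.subsetP => A /(fintype.subsetP DP)/PS.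
- by move=> A AS; apply: lt_le_trans (ww' A AS); exact: (weight_gt0 inv).
- move=> A AS; rewrite /w'; case: (boolP (A \in P)) => AP; last first.
    by rewrite mul0r addr0; exact: (weight_le inv).
  have := Pw A AP; have := weight_gt0 inv AS; rewrite -/w => ? ?.
  rewrite mul1r; suff : d A <= 1 / 2 by lra.
  by rewrite /d ler_pdivrMr; lra.
- rewrite big_split /= -[(augmentations st).+1%:R]natr1.
  suff : \sum_(A in S) (A \in P)%:R * d A <= 1 / 2 by have := weight_sum inv; rewrite -/w; lra.
  rewrite [leLHS](_ : _ = \sum_(A in P) d A)// [RHS]big_mkcond [LHS]big_mkcond /=.
  apply: eq_bigr => A _; case: (boolP (A \in P)) => AP; first by rewrite (PS _ AP) mul1r.
  by rewrite mul0r; case: ifP.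
- rewrite mulnS addnC; apply: leq_trans (leq_card_setU _ _) _.
  by rewrite leq_add ?(card_rounded inv).
- apply: le_trans (potential_le inv); rewrite -/C -/w.
  set q := expR (- (2 * l)).
  have q1 : q <= 1 by rewrite -[1]expR0 ler_expR; have := l_gt0; lra.
  (* A hit raises the cover count by at least one, as [D] avoids [C], which costs a factor [q]; a
     miss leaves at most [a i]. Both cases form one expression affine in [misses], to which [Dh]
     applies. *)
  apply: (@le_trans _ _ (\sum_i (q * a i + (1 - q) * (a i * (misses r D i)%:R)))).
    apply: ler_sum => i _.
    have wE : elt_weight w' i = elt_weight w i + rate i.
      rewrite /elt_weight big_split /=; congr (_ + _).
      rewrite /rate /hit_rate big_mkcond [RHS]big_mkcond/=.
      apply: eq_bigr => A _; case: (boolP (A \in P)) => AP.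
        by rewrite (PS _ AP) mul1r.
      by rewrite mul0r; case: ifP.
    have cov : (cover_count C i + ~~ misses r D i <= cover_count (chosen st') i)%N.
      apply: leq_trans (cover_countS i CC').
      case: (boolP (misses r D i)) => [_|]; rewrite /= ?addn0.
        by apply: cover_countS; exact: finset.subsetUl.
      move=> /forall_inPn[A AD]; rewrite negbK => iA.
      have AC : A \notin C by have := fintype.subsetP DP A AD; rewrite inE => /and3P[].
      rewrite addn1; apply: proper_card; apply/properP; split.
        by apply/fintype.subsetP => B; rewrite !inE => /andP[-> ->].
      exists A; first by rewrite inE finset.in_setU AD orbT.
      by rewrite inE (negbTE AC).
    move: cov; rewrite -(ler_nat R) natrD => cov.
    apply: (@le_trans _ _ (expR (2 * l * (elt_weight w' i
        - ((cover_count C i)%:R + (~~ misses r D i)%:R))))).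
      by rewrite ler_expR ler_wpM2l ?lerD2l ?lerN2//; have := l_gt0; lra.
    rewrite le_eqVlt; apply/orP; left; apply/eqP; rewrite wE.
    case: misses => /=.
      rewrite [RHS](_ : _ = a i); last by ring.
      by rewrite /a /phi -expRD; congr expR; ring.
    by rewrite !mulr0 addr0 /a /phi /q -!expRD; congr expR; ring.
  rewrite big_split /= -!big_distrr /=.
  apply: (@le_trans _ _ (q * (\sum_i a i) + (1 - q) * \sum_i a i * (1 - rate i) ^+ L)).
    by rewrite lerD2l ler_wpM2l//; lra.
  rewrite !big_distrr -big_split /=; apply: ler_sum => i _.
  rewrite [leLHS](_ : _ = phi i *
     (expR (2 * l * rate i) * (q + (1 - q) * (1 - rate i) ^+ L))); last first.
    by rewrite /a; ring.
  rewrite -[leRHS]mulr1 ler_wpM2l ?expR_ge0//.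
  by apply: rounding_factor; rewrite ?rate0// expl ler_nat.
- move=> Opt [OptS cov]; rewrite -[(augmentations st).+1%:R]natr1 mulrDr mulr1.
  (* Of the at least [k] sets of [Opt] containing [x], fewer than [(1 - eps) * k] lie in [C]; the
     others are in [P]. *)
  have many : eps * k%:R <= #|Opt :&: P|%:R.
    suff : k%:R <= (cover_count C x)%:R + #|Opt :&: P|%:R :> R by lra.
    rewrite -natrD ler_nat; apply: leq_trans (cov x) _.
    apply: leq_trans (leq_card_setU _ _); apply/subset_leq_card/fintype.subsetP => A.
    rewrite inE => /andP[AO xA].
    have AP : (A \in P) = (A \notin C) by rewrite inE (fintype.subsetP OptS) ?xA.
    rewrite finset.in_setU finset.in_setI AP AO inE xA andbT.
    by case: (A \in C).
  (* Each set of [Opt] in [P] gains [ln (1 + 1 / (2 * k)) >= 1 / (2 * k + 1) >= 1 / (3 * k)], and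
     [eps * k] such gains make [eps / 3]. *)
  apply: (@le_trans _ _ (\sum_(A in Opt) (ln (2 * m%:R * w A)
      + (A \in P)%:R / (3 * k%:R)))).
    rewrite big_split /= lerD ?(augmentations_log inv)//.
    rewrite -big_distrl /= ler_pdivlMr; last by lra.
    have -> : \sum_(A in Opt) (A \in P)%:R = #|Opt :&: P|%:R :> R.
      rewrite -sum1_card natr_sum big_mkcond [RHS]big_mkcond/=.
      by apply: eq_bigr => A _; rewrite finset.in_setI; case: (A \in Opt); case: (A \in P).
    by apply: le_trans many; lra.
  apply: ler_sum => A AO; have AS := fintype.subsetP OptS A AO.
  have w0 : 0 < w A := weight_gt0 inv AS.
  rewrite /w'; case: (boolP (A \in P)) => AP; last by rewrite !mul0r !addr0.
  have -> : 2 * m%:R * (w A + 1 * d A) = (2 * m%:R * w A) * (1 + (2 * k%:R)^-1).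
    by rewrite /d; ring.
  have v0 : 0 < (2 * k%:R)^-1 :> R by rewrite invr_gt0; lra.
  have p0 : 0 < 2 * m%:R * w A by rewrite !mulr_gt0.
  have p1 : 0 < 1 + (2 * k%:R)^-1 :> R by lra.
  rewrite [leRHS]lnM ?posrE// lerD2l.
  apply: le_trans (ln1D_ge (ltW v0)).
  have -> : (2 * k%:R)^-1 / (1 + (2 * k%:R)^-1) = (2 * k%:R + 1)^-1 :> R.
    by field; lra.
  by rewrite mul1r lef_pV2 ?posrE; lra.
Qed.

(** * Iterating augmentations into an online algorithm *)

(* The upper bound on the number of augmentations is what makes the loop stop. *)
Lemma settle s st : invariant s st ->
  exists st', [/\ invariant s st', chosen st \subset chosen st'
    & (exists Opt, is_cover S s Opt) -> covers_up_to eps s (chosen st')].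
Proof.
(* If no cover exists, nothing bounds the loop and nothing is promised, so the state is kept. *)
have [[Opt cov]|nocov] := pselect (exists Opt, is_cover S s Opt); last first.
  by move=> inv; exists st.
pose bound : R := 9 / eps * ln m%:R * #|Opt|%:R.
have [N] : exists N : nat, bound - (augmentations st)%:R < N%:R.
  by eexists; apply: le_lt_trans (ler_norm _) (archi_boundP (normr_ge0 _)).
elim: N st => [|N IH] st ltN inv.
  have := augmentations_le inv cov; rewrite -/bound.
  by move: ltN; rewrite subr_lt0 => /lt_le_trans h /h; rewrite ltxx.
have [done|/existsNP[x /negP]] := pselect (covers_up_to eps s (chosen st)).
  by exists st.
rewrite -ltNge => /(augment inv)[st1 [inv1 sub1 aug1]].
have [|st2 [inv2 sub2 cov2]] := IH st1 _ inv1.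
  by rewrite aug1; move: ltN; rewrite -!natr1; lra.
by exists st2; split => //; exact: fintype.subset_trans sub1 sub2.
Qed.

(* The history r is listed with the latest request first. *)
Fixpoint run (next : seq X * state -> state) (r : seq X) : state :=
  if r is x :: r' then next (rev r, run next r') else init.

Lemma online_algorithm : exists alg : seq X -> {set {set X}},
  is_online_algorithm S alg /\ forall s Opt, is_cover S s Opt ->
    covers_up_to eps s (alg s) /\
    #|alg s|%:R <= L.+1%:R * (9 / eps * ln m%:R * #|Opt|%:R).
Proof.
(* Fixing one successor for each history and state makes the algorithm a deterministic function of
   the history. *)
have /choice[next nextP] (p : seq X * state) : exists st', invariant p.1 p.2 ->
    [/\ invariant p.1 st', chosen p.2 \subset chosen st'
      & (exists Opt, is_cover S p.1 Opt) -> covers_up_to eps p.1 (chosen st')].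
  have [inv|ninv] := pselect (invariant p.1 p.2); last by exists init.
  by have [st' ?] := settle inv; exists st'.
have runP r : invariant (rev r) (run next r).
  elim: r => [|x r IH]; first exact: invariant_init.
  by case: (nextP (rev (x :: r), run next r)) => //; rewrite rev_cons; exact: invariant_rcons.
exists (fun s => chosen (run next (rev s))); split.
  split=> [s|s x]; first exact: chosen_sub (runP _).
  rewrite rev_rcons /=; case: (nextP (rev (x :: rev s), run next (rev s))) => //=.
  by rewrite rev_cons; apply: invariant_rcons.
move=> s Opt cov; split; last first.
  have inv := runP (rev s); rewrite revK in inv.
  apply: le_trans (_ : (L.+1 * augmentations (run next (rev s)))%:R <= _).
    by rewrite ler_nat (card_chosen inv).
  by rewrite natrM ler_wpM2l// (augmentations_le inv).
rewrite -{1}[s]revK; rewrite -[s]revK in cov; case: (rev s) cov => [|x r] cov.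
  by move=> y; rewrite mulr0.
case: (nextP (rev (x :: r), run next r)) => /= [|_ _]; last by apply; exists Opt.
by rewrite rev_cons; exact: invariant_rcons.
Qed.

End Algorithm.

Theorem theorem4 (R : realType) (eps : R) (eps_gt0 : 0 < eps) :
  exists K : R, 0 < K /\
  forall (X : finType) (S : {set {set X}}) (n m : nat),
    #|X| = n -> #|S| = m -> (2 <= n)%N -> (2 <= m)%N ->
    exists alg : seq X -> {set {set X}},
      is_online_algorithm S alg /\
      forall (s : seq X) (Opt : {set {set X}}), is_optimal_cover S s Opt ->
        (forall t : seq X, prefix t s -> covers_up_to eps t (alg t)) /\
        (#|alg s|)%:R <= K * (ln m%:R * ln n%:R) * (#|Opt|)%:R.
Proof.
(* [72 = 8 * 9]: the 9 comes from [augmentations_le]; with [L] the truncation of [4 * ln n] plus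
   one, [L + 1 <= 4 * ln n + 2 <= 8 * ln n] because [ln n >= 1 / 2]. *)
exists (72 / eps); split; first by rewrite divr_gt0.
move=> X S n m nE mE n2 m2; subst n m.
have ln_ge : 1 / 2 <= ln #|X|%:R :> R.
  apply: (@le_trans _ _ (ln 2)); last by rewrite ler_ln ?posrE ?ltr0n ?ler_nat//; lia.
  by have := ln1D_ge (ler01 : 0 <= 1 :> R); rewrite (_ : 1 + 1 = 2).
have ln_m : 0 <= ln #|S|%:R :> R by rewrite ln_ge0// ler1n; lia.
have l4 : 0 <= 4 * ln #|X|%:R :> R by lra.
have /andP[tr1 tr2] := truncn_itv l4.
have [alg [onl algP]] := online_algorithm eps_gt0 n2 m2 (ltW tr2).
exists alg; split => // s Opt [cov _]; split => [t /prefixP[u su]|].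
  (* [Opt] need not be optimal for the prefix [t]; feasibility there suffices. *)
  suff cov_t : is_cover S t Opt by have [] := algP t Opt cov_t.
  split; first exact: cov.1.
  by move=> y; apply: leq_trans (cov.2 y); rewrite su count_cat leq_addr.
have [_ h] := algP s Opt cov; apply: le_trans h _.
rewrite [leRHS](_ : _ =
    8 * ln #|X|%:R * (9 / eps * ln #|S|%:R * #|Opt|%:R)); last by field; lra.
rewrite ler_wpM2r ?mulr_ge0 ?invr_ge0 ?(ltW eps_gt0)//.
by rewrite -addn2 natrD; lra.
Qed.
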